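(* Let $N\geq 2$, $M\geq 1$ be integers and let $R$ be a positive integer. Let $\Lambda_1,\dots,\Lambda_M$ be sublattices of $\mathbb{Z}^N$ of rank $N-1$ each, such that $C_R^N \cap \mathbb{Z}^N \subset \bigcup_{i=1}^M \Lambda_i$. Then $$\sum_{i=1}^M \frac{1}{H(\Lambda_i)} \geq R-\sqrt{M}.$$
   Context: $C_R^N=\{\boldsymbol{x}\in\mathbb{R}^N:\max_{1\leq i\leq N}|x_i|\leq R\}$ is the closed cube of sidelength $2R$ centered at the origin. For a lattice (subgroup) $\Lambda\subseteq\mathbb{Z}^N$ of rank $J$, $1\leq J\leq N$, choose a $\mathbb{Z}$-basis $\boldsymbol{x}_1,\dots,\boldsymbol{x}_J$ and let $X=(\boldsymbol{x}_1\ \dots\ \boldsymbol{x}_J)$ be the $N\times J$ basis matrix. For each subset $I\subseteq\{1,\dots,N\}$ of cardinality $J$ let $X_I$ be the $J\times J$ submatrix formed by the rows of $X$ indexed by $I$. The height of the lattice is $H(\Lambda)=\max_{I}|\det(X_I)|$, which does not depend on the choice of basis. *)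

(* Defs.v *)
From mathcomp Require Import all_boot all_order all_algebra.
From mathcomp Require Import boolp classical_sets reals.

Set Implicit Arguments.
Unset Strict Implicit.
Unset Printing Implicit Defensive.
Import Order.TTheory GRing.Theory Num.Theory.
Local Open Scope classical_set_scope.
Local Open Scope ring_scope.

Definition cube (K : realType) (N : nat) (r : K) : set 'cV[K]_N :=
  [set x | \big[Num.max/0]_(i < N) `|x i 0| <= r].

Definition int_points (K : realType) (N : nat) (A : set 'cV[K]_N) :
    set 'cV[int]_N :=
  [set x | A (map_mx intr x)].

(* The columns of X are the basis vectors; X *m c ranges over their integral
   linear combinations. *)
Definition Zbasis (N J : nat) (L : set 'cV[int]_N) (X : 'M[int]_(N, J)) : Prop :=
  (forall c : 'cV[int]_J, X *m c = 0 -> c = 0)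
  /\ L = range (fun c : 'cV[int]_J => X *m c).

Definition sublattice_of_rank (N J : nat) (L : set 'cV[int]_N) : Prop :=
  GRing.zmod_closed (mem L) /\ exists X : 'M[int]_(N, J), Zbasis L X.

(* X_I: enum_val lists the elements of I in increasing order. *)
Definition row_minor (N J : nat) (X : 'M[int]_(N, J))
    (I : {I : {set 'I_N} | #|I| == J}) : 'M[int]_J :=
  rowsub (fun j : 'I_J => enum_val (cast_ord (esym (eqP (valP I))) j)) X.

Definition mx_height (N J : nat) (X : 'M[int]_(N, J)) : nat :=
  \max_(I : {I : {set 'I_N} | #|I| == J}) `|\det (row_minor X I)|%N.

(* Height of a lattice of rank J, computed from a chosen basis; by heightE the
   choice is irrelevant. Junk value if L has no basis of J vectors. *)
Definition height (N J : nat) (L : set 'cV[int]_N) : nat :=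
  mx_height (xget 0 [set X : 'M[int]_(N, J) | Zbasis L X]).

Lemma Zbasis_unimodular (N J : nat) (L : set 'cV[int]_N)
    (X Y : 'M[int]_(N, J)) :
  Zbasis L X -> Zbasis L Y ->
  exists2 U : 'M[int]_J, Y = X *m U & `|\det U|%N = 1%N.
Proof.
have sub (A B : 'M[int]_(N, J)) :
    Zbasis L A -> Zbasis L B -> exists U : 'M[int]_J, B = A *m U.
  move=> [_ LA] [_ LB].
  have /choice[f fP] (j : 'I_J) : exists c : 'cV[int]_J, A *m c = col j B.
    have : L (col j B) by rewrite LB colE; exists (delta_mx j 0).
    by rewrite LA => -[c _ <-]; exists c.
  exists (\matrix_(i, j) f j i 0); apply/matrixP => i j.
  have /matrixP/(_ i 0) := fP j; rewrite !mxE => <-.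
  by apply: eq_bigr => k _; rewrite mxE.
move=> bX bY; have [U YU] := sub _ _ bX bY; have [V XV] := sub _ _ bY bX.
exists U => //.
have UV : U *m V = 1%:M.
  apply/eqP; rewrite -subr_eq0; apply/eqP/matrixP => i j.
  have : col j (U *m V - 1%:M) = 0.
    rewrite colE; apply: bX.1.
    by rewrite mulmxA mulmxBr mulmxA -YU -XV mulmx1 subrr mul0mx.
  by move/matrixP/(_ i 0); rewrite !mxE.
have /(congr1 absz) : \det U * \det V = 1 by rewrite -det_mulmx UV det1.
by rewrite abszM => /eqP; rewrite muln_eq1 => /andP[/eqP].
Qed.

Lemma heightE (N J : nat) (L : set 'cV[int]_N) (X : 'M[int]_(N, J)) :
  Zbasis L X -> height J L = mx_height X.
Proof.
move=> bX; rewrite /height; case: xgetP => [Y _ /= bY|/(_ X)//].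
have [U -> U1] := Zbasis_unimodular bX bY.
apply: eq_bigr => I _.
have -> : row_minor (X *m U) I = row_minor X I *m U.
  by rewrite /row_minor mul_rowsub_mx.
by rewrite det_mulmx abszM U1 muln1.
Qed.

(* Main.v *)
Require Import Defs.
From mathcomp Require Import all_boot all_order all_algebra.
From mathcomp Require Import classical_sets reals.
From mathcomp Require Import boolp zify ring lra.

Set Implicit Arguments.
Unset Strict Implicit.
Unset Printing Implicit Defensive.
Import Order.TTheory GRing.Theory Num.Theory.
Local Open Scope classical_set_scope.
Local Open Scope ring_scope.

(** Projecting a lattice of rank [J] and height [H] onto the [J] coordinates of a
    maximal minor is injective, and the image has index [H] in Z^J.  A coset of a
    sublattice of index [h] in Z^J has at most (n/h + 1)(n+1)^(J-1) points in the
    box [0,n]^J: put a basis in lower block triangular form with diagonal entry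
    [d] in the first row, note that the first coordinate takes at most n/d + 1
    values, and apply induction to the fibres, using
    (n/d + 1)(n/h' + 1) <= (n/(d h') + 1)(n + 1).  With n = 2R and J = N-1, the
    covering of the (n+1)^N points of the cube gives
    (2R+1)^2 <= 2R * sum_i 1/H_i + M, which is stronger than the claim when
    sqrt M < R; otherwise the right-hand side of the claim is nonpositive. *)

(** Members of one residue class are told apart by their quotients by [d], which are at most
    [n %/ d]. The bound is multiplied through by [d] to stay in the naturals. *)
Lemma card_residue_class (n d : nat) (T : {set 'I_n.+1}) :
  (0 < d)%N -> {in T &, forall s t : 'I_n.+1, s = t %[mod d]} ->
  (#|T| * d <= n + d)%N.
Proof.
move=> d0 Tmod; have /card_in_imset <- :
    {in T &, injective (fun t : 'I_n.+1 => inord (t %/ d) : 'I_(n %/ d).+1)}.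
  move=> s t sT tT /(congr1 val) /=.
  have lt (u : 'I_n.+1) : (u %/ d < (n %/ d).+1)%N.
    by rewrite ltnS leq_div2r // -ltnS.
  rewrite !inordK // => st; apply/val_inj => /=.
  by rewrite (divn_eq s d) (divn_eq t d) st (Tmod s t).
apply: (@leq_trans ((n %/ d).+1 * d)); last first.
  by rewrite mulSn addnC leq_add2r leq_divM.
by rewrite leq_mul2r orbC -[X in (_ <= X)%N]card_ord max_card.
Qed.

Lemma mulmx_det_inj (J : nat) (A : 'M[int]_J) :
  \det A != 0 -> injective (mulmx A : 'cV_J -> 'cV_J).
Proof.
move=> A0 c c' /(congr1 (mulmx (\adj A))).
rewrite !mulmxA !mul_adj_mx !mul_scalar_mx => /matrixP cc'.
by apply/matrixP => i j; have := cc' i j; rewrite !mxE => /(mulfI A0).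
Qed.

(** Smith normal form of the first row alone gives a [U] whose inverse, acting by column operations,
    clears that row past its first entry. The factor [U] only changes the basis of the column
    lattice. *)
Lemma unimodular_lblock (J : nat) (A : 'M[int]_(1 + J)) :
  exists2 U : 'M[int]_(1 + J), U \in unitmx &
  exists d u B, A = block_mx d%:M 0 u B *m U.
Proof.
have [P _ [U uU [e _ eE]]] := int_Smith_normal_form (usubmx A).
exists U => //; pose A' := A *m invmx U.
exists (A' 0 0), (dlsubmx A'), (drsubmx A').
have rE : ursubmx A' = 0.
  rewrite /ursubmx /A' -mul_usub_mx eE mulmxK // -[X in P *m X]hsubmxK mul_mx_row.
  rewrite row_mxKr; apply/matrixP => i j; rewrite !mxE big1 // => k _.
  by rewrite !mxE (ord1 k) mulr0.
have lE : ulsubmx A' = (A' 0 0)%:M.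
  apply/matrixP => i j; rewrite !ord1 [RHS]mxE eqxx mulr1n /ulsubmx 2!mxE.
  by congr (A' _ _); apply/val_inj.
by rewrite -lE -[X in block_mx _ X]rE submxK mulmxKV.
Qed.

(** Multiplying the bound by h(n+1), where h is the absolute determinant, avoids division and the
    exponent J-1, so the induction can start at J = 0. The shift [w] is there because the fibres of
    a lattice over its first coordinate are cosets. *)
Lemma card_coset_box (n J : nat) (A : 'M[int]_J) (w : 'cV[int]_J)
    (S : {set 'cV['I_n.+1]_J}) :
  \det A != 0 ->
  {in S, forall f : 'cV['I_n.+1]_J,
    exists c, map_mx (fun t : 'I_n.+1 => t%:Z) f = A *m c + w} ->
  (#|S| * n.+1 * `|\det A| <= (n + `|\det A|) * n.+1 ^ J)%N.
Proof.
elim: J => [|J IH] in A w S *.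
  move=> _ _; rewrite det_mx00 absz1 muln1 addn1 mulnC leq_mul2l /=.
  by apply: leq_trans (max_card _) _; rewrite card_mx mul0n.
have [U uU [d [u [B ->]]]] := unimodular_lblock (A : 'M_(1 + J)).
have U1 : `|\det U|%N = 1%N.
  by move: uU; rewrite unitmxE; case/orP => /eqP ->.
rewrite det_mulmx (@det_lblock _ 1 J) det_scalar expr1 !abszM U1 muln1.
rewrite !mulf_eq0 !negb_or => /andP[/andP[d0 B0] _] SE.
(* With [U] absorbed into the coefficients, the first coordinate depends on [c0] alone, and the
   others lie in a coset of the lattice of [B] that depends only on [c0]. *)
have {}SE : {in S, forall f : 'cV['I_n.+1]_J.+1,
    exists (c0 : int) (c : 'cV[int]_J),
    (f 0 0)%:Z = d * c0 + w 0 0 /\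
    map_mx (fun t : 'I_n.+1 => t%:Z) (@dsubmx 'I_n.+1 1 J 1 f) =
      B *m c + (u *m c0%:M + @dsubmx _ 1 J 1 w)}.
  move=> f /SE[c]; rewrite -mulmxA; set c' := (U *m c : 'cV_(1 + J)) => fE.
  exists (c' 0 0), (dsubmx c').
  have -> : (c' 0 0)%:M = usubmx c'.
    apply/matrixP => i j; rewrite !ord1 [LHS]mxE eqxx mulr1n [RHS]mxE.
    by congr (c' _ _); apply/val_inj.
  have bE : block_mx d%:M 0 u B *m c' =
      col_mx (d%:M *m usubmx c') (u *m usubmx c' + B *m dsubmx c').
    by rewrite -{1}[c']vsubmxK mul_block_col mul0mx addr0.
  rewrite bE in fE; split.
    have /matrixP/(_ 0 0) := congr1 (@usubmx int 1 J 1) fE.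
    rewrite raddfD /= col_mxKu mul_scalar_mx !mxE.
    by rewrite (_ : lshift J 0 = 0) //; apply/val_inj.
  by rewrite map_dsubmx fE raddfD /= col_mxKd addrCA addrA.
have [T TE] : exists T : {set 'I_n.+1},
    forall t, (t \in T) = [exists f in S, f 0 0 == t].
  by exists [set t | [exists f in S, f 0 0 == t]]%SET => t; rewrite inE.
(* First coordinates are all congruent to [w 0 0] modulo [d], whose sign is arbitrary. *)
have Tcard : (#|T| * `|d| <= n + `|d|)%N.
  apply: card_residue_class => [|s t]; first by rewrite absz_gt0.
  rewrite !TE => /exists_inP[f /SE[c0 [_ [fE _]]] /eqP <-].
  move=> /exists_inP[g /SE[c1 [_ [gE _]]] /eqP <-].
  have : modz (f 0 0) `|d|%N = modz (g 0 0) `|d|%N.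
    by rewrite !modz_abs fE gE ![d * _]mulrC !modzMDl.
  by rewrite !modz_nat => -[].
pose fiber t := [set f in S | f 0 0 == t]%SET.
(* Since [d] is nonzero, [t] determines [c0], so the remaining coordinates of a whole fibre lie in a
   single coset. *)
have fib t : t \in T ->
    (#|fiber t| * n.+1 * `|\det B| <= (n + `|\det B|) * n.+1 ^ J)%N.
  rewrite TE => /exists_inP[f0 /SE[c0 [_ [f0E _]]] /eqP f0t].
  rewrite -(@card_in_imset _ _ (fun f => @dsubmx _ 1 J 1 f)); last first.
    move=> f g; rewrite !inE => /andP[_ /eqP ft] /andP[_ /eqP gt] /= fg.
    rewrite -[f](@vsubmxK _ 1 J) -[g](@vsubmxK _ 1 J) fg; congr col_mx.
    apply/matrixP => i j; rewrite !ord1 !mxE.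
    by rewrite (_ : lshift J 0 = 0) ?ft ?gt //; apply/val_inj.
  apply: (IH _ (u *m c0%:M + @dsubmx _ 1 J 1 w)) => // _ /imsetP[f + ->].
  rewrite inE => /andP[/SE[c1 [c [fE dE]]] /eqP ft]; exists c.
  rewrite dE; congr (_ + (_ *m _%:M + _)).
  by apply: (mulfI d0); apply: (addIr (w 0 0)); rewrite -fE -f0E f0t ft.
have Scard : #|S| = (\sum_(t in T) #|fiber t|)%N.
  rewrite -sum1_card
    (partition_big (fun f : 'cV_J.+1 => f 0 0) (mem T)) /=; last first.
    by move=> f fS; rewrite TE; apply/exists_inP; exists f.
  by apply: eq_bigr => t _; rewrite -sum1_card; apply: eq_bigl => f; rewrite inE.
have : (#|S| * n.+1 * `|\det B| <= #|T| * ((n + `|\det B|) * n.+1 ^ J))%N.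
  rewrite Scard !big_distrl /= -sum_nat_const; exact: leq_sum.
move: Tcard; rewrite expnS; rewrite -absz_gt0 in d0; rewrite -absz_gt0 in B0.
move: d0 B0; move: #|T| #|S| `|d|%N `|\det B|%N (n.+1 ^ J)%N
  => T' S' d' b E d0 b0 le1 le2.
(* The right side minus the left side is n(d' - 1)(b - 1). *)
have le3 : ((n + d') * (n + b) <= (n + d' * b) * n.+1)%N.
  case: d' d0 {le1} => // d' _; case: b b0 {le2} => // b _.
  by have := leq0n (n * (d' * b)); nia.
apply: (@leq_trans (T' * d' * ((n + b) * E))); first by nia.
apply: (@leq_trans ((n + d') * ((n + b) * E))).
  by rewrite leq_mul2r le1 orbT.
by rewrite !mulnA leq_mul2r le3 orbT.
Qed.

Lemma common_denominator (J : nat) (c : 'cV[rat]_J) :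
  exists2 k : int, k != 0 & exists c' : 'cV[int]_J, map_mx intr c' = k%:~R *: c.
Proof.
exists (\prod_i denq (c i 0)); first by apply/prodf_neq0 => i; rewrite denq_neq0.
exists (\col_i (numq (c i 0) * \prod_(j | j != i) denq (c j 0))).
apply/matrixP => i j; rewrite ord1 !mxE [in RHS](bigD1 i) //= !intrM.
rewrite [X in _ = _ * X](esym (divq_num_den _)).
by field; rewrite intr_eq0 denq_neq0.
Qed.

(** A rational kernel vector becomes integral after clearing denominators, so [X] has full column
    rank over the rationals and some J of its rows are independent. *)
Lemma nonsingular_minor (N J : nat) (X : 'M[int]_(N, J)) :
  (forall c : 'cV_J, X *m c = 0 -> c = 0) ->
  exists I, \det (row_minor X I) != 0.
Proof.
move=> Xinj; pose Q (m n : nat) (A : 'M[int]_(m, n)) := map_mx (intr : int -> rat) A.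
have Qfull : row_full (Q _ _ X).
  rewrite /row_full -mxrank_tr -[_ == _]/(row_free (Q _ _ X)^T) -kermx_eq0.
  apply/eqP/row_matrixP => i; rewrite row0.
  set v := row i _; have : Q _ _ X *m v^T = 0.
    apply: trmx_inj; rewrite trmx_mul trmxK trmx0; apply/eqP.
    by rewrite -sub_kermx row_sub.
  have [k k0 [c cE]] := common_denominator v^T.
  move/(congr1 ( *:%R k%:~R)); rewrite scaler0 scalemxAr -cE -map_mxM /= => XC.
  have {}XC : X *m c = 0.
    apply/matrixP => a b; have /matrixP/(_ a b) := XC.
    by rewrite !mxE => /eqP; rewrite intr_eq0 => /eqP.
  move: cE; rewrite (Xinj _ XC) map_mx0 => /esym/eqP.
  rewrite scalemx_eq0 intr_eq0 (negPf k0) /= => /eqP vT.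
  by apply: trmx_inj; rewrite vT trmx0.
pose I := [set fullrankfun Qfull j | j : 'I_J]%SET.
have Icard : #|I| == J.
  by rewrite card_imset ?card_ord //; apply: fullrankfun_inj.
exists (exist (fun I : {set 'I_N} => #|I| == J) I Icard); set Y := row_minor _ _.
rewrite -(intr_eq0 rat) -det_map_mx -unitfE -unitmxE -row_full_unit /row_full eqn_leq rank_leq_row /=.
(* [row_minor] lists the chosen rows in increasing order, [fullrankfun] possibly in another;
   comparing row spaces makes the order irrelevant. *)
rewrite -{1}(mxrank_fullrowsub Qfull) mxrankS //.
apply/row_subP => j.
have jI : fullrankfun Qfull j \in I by exact: imset_f.
pose k := cast_ord (eqP Icard) (enum_rank_in jI (fullrankfun Qfull j)).
rewrite (_ : row j _ = row k (map_mx intr Y)) ?row_sub //.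
apply/rowP => l; rewrite !mxE /=; congr (X _ l)%:~R.
by rewrite /k cast_ord_comp cast_ord_id enum_rankK_in.
Qed.

Lemma height_gt0 (N J : nat) (L : set 'cV[int]_N) (X : 'M[int]_(N, J)) :
  Zbasis L X -> (0 < height J L)%N.
Proof.
move=> bX; rewrite (heightE bX); have [I I0] := nonsingular_minor bX.1.
by rewrite -absz_gt0 in I0; apply: leq_trans I0 _; apply: leq_bigmax.
Qed.

Lemma card_lattice_cube (N J n : nat) (L : set 'cV[int]_N)
    (w : 'cV[int]_N) (S : {set 'cV['I_n.+1]_N}) :
  (exists X : 'M[int]_(N, J), Zbasis L X) ->
  {in S, forall f : 'cV['I_n.+1]_N,
    L (map_mx (fun t : 'I_n.+1 => t%:Z) f - w)} ->
  (#|S| * n.+1 * height J L <= (n + height J L) * n.+1 ^ J)%N.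
Proof.
move=> [X bX] SL; have H0 := height_gt0 bX; rewrite (heightE bX) in H0 *.
have [I IE] : exists I, mx_height X = `|\det (row_minor X I)|%N.
  have [I0 _] := nonsingular_minor bX.1.
  (* A maximum is attained only over a nonempty index type; the nonsingular minor supplies an
     element. *)
  have pos : (0 < #|{: {I : {set 'I_N} | #|I| == J}}|)%N.
    by apply/card_gt0P; exists I0.
  have [I IE] := bigop.eq_bigmax (fun I => `|\det (row_minor X I)|%N) pos.
  by exists I; exact: IE.
rewrite IE absz_gt0 in H0 *.
pose g := fun j : 'I_J => enum_val (cast_ord (esym (eqP (valP I))) j).
have SE : {in S, forall f : 'cV['I_n.+1]_N, exists c : 'cV_J,
    map_mx (fun t : 'I_n.+1 => t%:Z) f = X *m c + w}.
  by move=> f /SL; rewrite bX.2 => -[c _ cE]; exists c; rewrite cE subrK.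
have gE c : rowsub g (X *m c + w) = row_minor X I *m c + rowsub g w.
  by rewrite raddfD /= -mul_rowsub_mx.
rewrite -(@card_in_imset _ _ (fun f : 'cV['I_n.+1]_N => rowsub g f)); last first.
  move=> f f' /SE[c fE] /SE[c' fE'] /= ff'.
  have fc : rowsub g (X *m c + w) = rowsub g (X *m c' + w).
    by rewrite -fE -fE' -!map_mxsub ff'.
  rewrite !gE in fc; move/addIr/(mulmx_det_inj H0): fc fE' => <-.
  rewrite -fE => /matrixP e; apply/matrixP => i j.
  by have := e i j; rewrite !mxE => -[] /val_inj.
apply: (@card_coset_box _ _ _ (rowsub g w)) => // _ /imsetP[f /SE[c fE] ->].
by exists c; rewrite map_mxsub fE gE.
Qed.

Theorem corollary6p1 (K : realType) (N M R : nat) (L : 'I_M -> set 'cV[int]_N)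
    (hN : (2 <= N)%N) (hM : (1 <= M)%N) (hR : (0 < R)%N)
    (hL : forall i : 'I_M, sublattice_of_rank N.-1 (L i))
    (hcover : int_points (@cube K N R%:R) `<=` \bigcup_(i in [set: 'I_M]) L i) :
  \sum_(i < M) ((height N.-1 (L i))%:R : K)^-1 >= R%:R - Num.sqrt (M%:R : K).
Proof.
set S := \sum_(i < M) _; have [n nE] : {n | n = R.*2} by exists R.*2.
(* Translation by [w] carries the cube to the box [0, 2R]^N, whose points are vectors of ordinals
   below 2R + 1. *)
pose w : 'cV[int]_N := const_mx R%:Z.
pose z (f : 'cV['I_n.+1]_N) := map_mx (fun t : 'I_n.+1 => t%:Z) f - w.
pose P i := [set f | `[< L i (z f) >]]%SET.
have cover : (n.+1 ^ N <= \sum_(i < M) #|P i|)%N.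
  have -> : (n.+1 ^ N)%N = #|{: 'cV['I_n.+1]_N}| by rewrite card_mx card_ord muln1.
  suff -> : #|{: 'cV['I_n.+1]_N}| = #|\bigcup_i P i|%SET.
    elim/big_ind2: _ => [|A a B b Aa Bb|//]; first by rewrite cards0.
    by rewrite (leq_trans (leq_card_setU _ _)) ?leq_add.
  apply: eq_card => f; rewrite inE; apply/esym/bigcupP.
  have [|i _ Li] := hcover (z f).
    rewrite /int_points /cube /=; elim/big_ind: _ => // [x y xR yR|i _].
      by rewrite ge_max xR.
    rewrite !mxE -intr_norm -[R%:R]/(R%:Z%:~R) ler_int.
    rewrite ler_norml; have := ltn_ord (f i 0).
    by move: (nat_of_ord _) => t; lia.
  by exists i => //; rewrite inE; apply/asboolP.
have height0 i : (0 < height N.-1 (L i))%N by have [_ [X /height_gt0]] := hL i.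
have cardP i :
    #|P i|%:R <= (n%:R * (height N.-1 (L i))%:R^-1 + 1) * n.+1%:R ^+ N.-2 :> K.
  have PL : {in P i, forall f : 'cV['I_n.+1]_N, L i (z f)}.
    by move=> f; rewrite inE => /asboolP.
  have := card_lattice_cube (hL i).2 PL.
  rewrite -(ler_nat K) !natrM natrD natrX.
  (* Here N >= 2 lets one factor n + 1 split off, which cancels against the one on the left. *)
  rewrite (_ : n.+1%:R ^+ N.-1 = n.+1%:R * n.+1%:R ^+ N.-2); last first.
    by rewrite -exprS; congr (_ ^+ _); lia.
  have : 0 < (height N.-1 (L i))%:R :> K by rewrite ltr0n.
  have : 0 < n.+1%:R :> K by rewrite ltr0n.
  move: (height _ _)%:R n.+1%:R (#|_|%:R) (_ ^+ _) => h q p e q0 h0 le.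
  rewrite -(ler_pM2r q0) -(ler_pM2r h0); apply: le_trans le _.
  by rewrite le_eqVlt; apply/orP; left; apply/eqP; field; rewrite gt_eqF.
have S0 : 0 <= S by apply: sumr_ge0 => i _; rewrite invr_ge0.
have main : n.+1%:R ^+ 2 <= n%:R * S + M%:R.
  have q0 : 0 < n.+1%:R ^+ N.-2 :> K by rewrite exprn_gt0.
  rewrite -(ler_pM2r q0) -exprD (_ : (2 + N.-2)%N = N); last by lia.
  apply: (@le_trans _ _ (\sum_(i < M) #|P i|%:R)).
    by rewrite -natr_sum -(natrX K n.+1 N) ler_nat.
  have -> : M%:R = \sum_(i < M) 1 :> K by rewrite sumr_const card_ord.
  rewrite /S mulr_sumr -big_split /= mulr_suml.
  exact: ler_sum.
have R0 : 0 < R%:R :> K by rewrite ltr0n.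
have t0 : 0 <= Num.sqrt (M%:R : K) by apply: sqrtr_ge0.
have t2 : Num.sqrt (M%:R : K) ^+ 2 = M%:R by apply: sqr_sqrtr.
move: main t0 t2; rewrite -natr1 nE -muln2 natrM.
move: (M%:R : K) (Num.sqrt (M%:R : K)) (R%:R : K) S R0 S0
  => m t r s r0 s0 main t0 m2.
case: (lerP r t) => [rt|tr]; first by rewrite (le_trans _ s0) ?subr_le0.
rewrite leNgt; apply/negP => sr.
(* As 0 <= t < r, [main] would give (2r + 1)^2 < 2r^2 - 2rt + t^2 <= 2r^2, which is absurd. *)
have : r * s < r * (r - t) by rewrite ltr_pM2l.
by nra.
Qed.
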